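(* Let $\Delta^{\mathrm{inv}}_\ast:\mathcal{H}^{\mathrm{inv}}\to\mathcal{H}^{\mathrm{inv}}\ast\mathcal{H}^{\mathrm{inv}}$ be the operator defined on the generators by $$\Delta^{\mathrm{inv}}_\ast b_n=\sum_{k=0}^n b_k\otimes b_{n-k}\qquad(b_0:=1),$$ and extended as an algebra homomorphism. Then $\Delta^{\mathrm{inv}}_\ast$ is co-associative. Moreover, let $\mathcal{H}^{\mathrm{inv}}_\ast$ denote the algebra $\mathcal{H}^{\mathrm{inv}}$ endowed with $\Delta^{\mathrm{inv}}_\ast$, and let $\mathcal{A}$ be an associative unital algebra. Then $\mathrm{Hom}_{Alg}(\mathcal{H}^{\mathrm{inv}}_\ast,\mathcal{A})$ is a group with group law given by the convolution. In addition, the groups $G^{\mathrm{inv}}(\mathcal{A})$ and $\mathrm{Hom}_{Alg}(\mathcal{H}^{\mathrm{inv}}_\ast,\mathcal{A})$ are isomorphic to each other.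
   Context: All algebras are associative unital $\mathbb{C}$-algebras, and $\mathrm{Hom}_{Alg}$ denotes the set of unital algebra homomorphisms. $\mathcal{H}^{\mathrm{inv}}=\mathbb{C}\langle b_1,b_2,\dots\rangle$ is the free associative unital algebra on infinitely many variables $b_n$, $n\ge1$. For unital associative algebras $\mathcal{A},\mathcal{B}$, the free product $\mathcal{A}\ast\mathcal{B}$ is their co-product (sum) in the category of unital associative algebras; it is spanned by alternating products of elements of $\mathcal{A}$ and $\mathcal{B}$, and $\mathcal{A}\otimes\mathcal{B}$ is viewed as a sub-space of it, $a\otimes b$ standing for the product in $\mathcal{A}\ast\mathcal{B}$ of $a$ (from $\mathcal{A}$) followed by $b$ (from $\mathcal{B}$). Co-associativity of $\Delta^{\mathrm{inv}}_\ast$ means $(\Delta^{\mathrm{inv}}_\ast\ast\mathrm{Id})\circ\Delta^{\mathrm{inv}}_\ast=(\mathrm{Id}\ast\Delta^{\mathrm{inv}}_\ast)\circ\Delta^{\mathrm{inv}}_\ast$. Let $m_\ast:\mathcal{A}\ast\mathcal{A}\to\mathcal{A}$ be the algebra homomorphism that is the identity on each copy of $\mathcal{A}$ (extending the multiplication $\mathcal{A}\otimes\mathcal{A}\to\mathcal{A}$). The convolution of $\alpha,\beta\in\mathrm{Hom}_{Alg}(\mathcal{H}^{\mathrm{inv}}_\ast,\mathcal{A})$ is $\alpha\beta:=m_\ast\circ(\alpha\ast\beta)\circ\Delta^{\mathrm{inv}}_\ast$. Finally, $$G^{\mathrm{inv}}(\mathcal{A})=\Big\{f(x)=1+\sum_{n=1}^\infty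 f_nx^n:\ f_n\in\mathcal{A}\Big\}$$ is the group of formal power series (the variable $x$ commuting with the coefficients) with the multiplication $(fg)(x)=f(x)g(x)=1+\sum_{n\ge1}\sum_{k=0}^nf_kg_{n-k}x^n$. *)

(* Defs.v *)
From HB Require Import structures.
From mathcomp Require Import all_boot all_algebra finmap.
From mathcomp.multinomials Require Import monalg.
From mathcomp Require Import boolp.

Set Implicit Arguments.
Unset Strict Implicit.
Unset Printing Implicit Defensive.

Import GRing.Theory.
Local Open Scope ring_scope.
Local Open Scope quotient_scope.

(* Associative unital K-algebras and their unital homomorphisms.  GRing.Algebra
   excludes the zero algebra, and Hierarchy-Builder does not allow the join of
   GRing.Lmodule and GRing.PzRing to be declared after GRing.Lalgebra, so the
   scalar multiplication is axiomatised here on top of GRing.PzRing. *)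
HB.mixin Record PzRing_isUAlgebra (K : pzRingType) A of GRing.PzRing A := {
  uscale : K -> A -> A;
  uscaleA : forall a b x, uscale a (uscale b x) = uscale (a * b) x;
  uscale1 : forall x, uscale 1 x = x;
  uscaleDr : forall a x y, uscale a (x + y) = uscale a x + uscale a y;
  uscaleDl : forall a b x, uscale (a + b) x = uscale a x + uscale b x;
  uscaleAl : forall a x y, uscale a (x * y) = uscale a x * y;
  uscaleAr : forall a x y, uscale a (x * y) = x * uscale a y
}.

#[short(type="ualgType")]
HB.structure Definition UAlgebra (K : pzRingType) :=
  {A of GRing.PzRing A & PzRing_isUAlgebra K A}.

HB.mixin Record isUScalable (K : pzRingType) (A B : ualgType K) (f : A -> B) := {
  uscalable_subproof : forall (a : K) x, f (uscale a x) = uscale a (f x)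
}.

#[short(type="ualgHom")]
HB.structure Definition UAlgHom (K : pzRingType) (A B : ualgType K) :=
  {f of @GRing.RMorphism A B f & isUScalable K A B f}.

Section AlgHomTheory.
Variable K : pzRingType.
Implicit Types A B C : ualgType K.

Lemma uscalable A B (f : ualgHom A B) a x : f (uscale a x) = uscale a (f x).
Proof. exact: uscalable_subproof. Qed.

Lemma uscaler0 A (a : K) : uscale a (0 : A) = 0.
Proof. by apply: (addrI (uscale a 0)); rewrite -uscaleDr !addr0. Qed.

Lemma uscale0r A (x : A) : uscale (0 : K) x = 0.
Proof. by apply: (addrI (uscale 0 x)); rewrite -uscaleDl !addr0. Qed.

Lemma uscaleN1r A (x : A) : uscale (-1 : K) x = - x.
Proof.
by apply: (addrI x); rewrite -{1}[x](uscale1 (s := A)) -uscaleDl !subrr uscale0r.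
Qed.

Lemma uscale_sumr A (a : K) (I : Type) (r : seq I) (F : I -> A) :
  uscale a (\sum_(i <- r) F i) = \sum_(i <- r) uscale a (F i).
Proof. exact: (big_morph _ (uscaleDr a) (uscaler0 A a)). Qed.

Lemma ualgHomP A B (f g : ualgHom A B) : f =1 g -> f = g.
Proof.
case: f g => [f [[f1] [f2] [f3]]] [g [[g1] [g2] [g3]]] /= /funext fg.
move: g1 g2 g3; rewrite -fg => g1 g2 g3.
by rewrite (Prop_irrelevance g1 f1) (Prop_irrelevance g2 f2)
  (Prop_irrelevance g3 f3).
Qed.

HB.instance Definition _ A := isUScalable.Build K A A idfun (fun a x => erefl).

Lemma comp_uscalable A B C (g : ualgHom B C) (f : ualgHom A B) (a : K) x :
  (g \o f) (uscale a x) = uscale a ((g \o f) x).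
Proof. by rewrite /= !uscalable. Qed.

HB.instance Definition _ A B C (g : ualgHom B C) (f : ualgHom A B) :=
  isUScalable.Build K A C (g \o f) (comp_uscalable g f).

Definition hom_id A : ualgHom A A := UAlgHom.clone K A A idfun _.
Definition hom_comp A B C (g : ualgHom B C) (f : ualgHom A B) : ualgHom A C :=
  UAlgHom.clone K A C (g \o f) _.
End AlgHomTheory.

Notation "g \oh f" := (hom_comp g f) (at level 50, left associativity).

(* The free product of A and B: formal expressions in elements of A and B,
   modulo the congruence generated by the axioms of associative unital algebras
   and by the relations making A and B embed homomorphically.  Its universal
   property is freeprod_inlK, freeprod_inrK and freeprod_hom_eq below. *)
Section FreeProduct.
Variables (K : pzRingType) (A B : ualgType K).

Inductive fterm : Type :=
| FLeft of A
| FRight of B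
| FAdd of fterm & fterm
| FMul of fterm & fterm
| FScale of K & fterm.

Inductive fcong : fterm -> fterm -> Prop :=
| fc_refl t : fcong t t
| fc_sym t u : fcong t u -> fcong u t
| fc_trans t u v : fcong t u -> fcong u v -> fcong t v
| fc_add t t' u u' : fcong t t' -> fcong u u' -> fcong (FAdd t u) (FAdd t' u')
| fc_mul t t' u u' : fcong t t' -> fcong u u' -> fcong (FMul t u) (FMul t' u')
| fc_scale a t t' : fcong t t' -> fcong (FScale a t) (FScale a t')
| fc_addA t u v : fcong (FAdd t (FAdd u v)) (FAdd (FAdd t u) v)
| fc_addC t u : fcong (FAdd t u) (FAdd u t)
| fc_add0 t : fcong (FAdd (FLeft 0) t) t
| fc_addN t : fcong (FAdd (FScale (-1) t) t) (FLeft 0)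
| fc_mulA t u v : fcong (FMul t (FMul u v)) (FMul (FMul t u) v)
| fc_mul1l t : fcong (FMul (FLeft 1) t) t
| fc_mul1r t : fcong (FMul t (FLeft 1)) t
| fc_mulDl t u v : fcong (FMul (FAdd t u) v) (FAdd (FMul t v) (FMul u v))
| fc_mulDr t u v : fcong (FMul t (FAdd u v)) (FAdd (FMul t u) (FMul t v))
| fc_scaleA a b t : fcong (FScale a (FScale b t)) (FScale (a * b) t)
| fc_scale1 t : fcong (FScale 1 t) t
| fc_scaleDr a t u :
    fcong (FScale a (FAdd t u)) (FAdd (FScale a t) (FScale a u))
| fc_scaleDl a b t :
    fcong (FScale (a + b) t) (FAdd (FScale a t) (FScale b t))
| fc_scaleAl a t u : fcong (FScale a (FMul t u)) (FMul (FScale a t) u)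
| fc_scaleAr a t u : fcong (FScale a (FMul t u)) (FMul t (FScale a u))
| fc_leftD x y : fcong (FLeft (x + y)) (FAdd (FLeft x) (FLeft y))
| fc_leftM x y : fcong (FLeft (x * y)) (FMul (FLeft x) (FLeft y))
| fc_leftZ a x : fcong (FLeft (uscale a x)) (FScale a (FLeft x))
| fc_rightD x y : fcong (FRight (x + y)) (FAdd (FRight x) (FRight y))
| fc_rightM x y : fcong (FRight (x * y)) (FMul (FRight x) (FRight y))
| fc_rightZ a x : fcong (FRight (uscale a x)) (FScale a (FRight x))
| fc_right1 : fcong (FRight 1) (FLeft 1).

HB.instance Definition _ := gen_eqMixin fterm.
HB.instance Definition _ := gen_choiceMixin fterm.

Definition fcongb (t u : fterm) : bool := `[< fcong t u >].

Lemma fcongb_refl : reflexive fcongb.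
Proof. by move=> t; apply/asboolP/fc_refl. Qed.

Lemma fcongb_sym : symmetric fcongb.
Proof. by move=> t u; apply/asboolP/asboolP => /fc_sym. Qed.

Lemma fcongb_trans : transitive fcongb.
Proof.
move=> u t v /asboolP tu /asboolP uv; apply/asboolP; exact: fc_trans tu uv.
Qed.

Canonical fcongb_equiv := EquivRel fcongb fcongb_refl fcongb_sym fcongb_trans.

Definition fprod := {eq_quot fcongb_equiv}.

HB.instance Definition _ := Choice.on fprod.

Definition fclass (t : fterm) : fprod := \pi_({eq_quot fcongb_equiv}) t.
Definition frep (x : fprod) : fterm := repr (x : {eq_quot fcongb_equiv}).

Lemma fclass_rep x : fclass (frep x) = x.
Proof. exact: reprK. Qed.

Lemma fclassP t u : fclass t = fclass u <-> fcong t u.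
Proof.
split; first by move=> /eqmodP /= /asboolP.
by move=> tu; apply/eqmodP/asboolP.
Qed.

Lemma frepP t : fcong (frep (fclass t)) t.
Proof. by apply/fclassP; rewrite fclass_rep. Qed.

Lemma fprod_ind (P : fprod -> Prop) : (forall t, P (fclass t)) -> forall x, P x.
Proof. by move=> Pt x; rewrite -(fclass_rep x). Qed.

Definition fpadd x y := fclass (FAdd (frep x) (frep y)).
Definition fpmul x y := fclass (FMul (frep x) (frep y)).
Definition fpscale a x := fclass (FScale a (frep x)).

Lemma fpaddE t u : fpadd (fclass t) (fclass u) = fclass (FAdd t u).
Proof. by apply/fclassP; apply: fc_add; apply: frepP. Qed.

Lemma fpmulE t u : fpmul (fclass t) (fclass u) = fclass (FMul t u).
Proof. by apply/fclassP; apply: fc_mul; apply: frepP. Qed.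

Lemma fpscaleE a t : fpscale a (fclass t) = fclass (FScale a t).
Proof. by apply/fclassP; apply: fc_scale; apply: frepP. Qed.

Let fpE := (fpaddE, fpmulE, fpscaleE).

Fact fpaddA : associative fpadd.
Proof.
by elim/fprod_ind=> t; elim/fprod_ind=> u; elim/fprod_ind=> v;
  rewrite !fpE; apply/fclassP/fc_addA.
Qed.

Fact fpaddC : commutative fpadd.
Proof.
by elim/fprod_ind=> t; elim/fprod_ind=> u; rewrite !fpE; apply/fclassP/fc_addC.
Qed.

Fact fpadd0 : left_id (fclass (FLeft 0)) fpadd.
Proof. by elim/fprod_ind=> t; rewrite !fpE; apply/fclassP/fc_add0. Qed.

Fact fpaddN : left_inverse (fclass (FLeft 0)) (fpscale (-1)) fpadd.
Proof. by elim/fprod_ind=> t; rewrite !fpE; apply/fclassP/fc_addN. Qed.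

HB.instance Definition _ :=
  GRing.isZmodule.Build fprod fpaddA fpaddC fpadd0 fpaddN.

Fact fpmulA : associative fpmul.
Proof.
by elim/fprod_ind=> t; elim/fprod_ind=> u; elim/fprod_ind=> v;
  rewrite !fpE; apply/fclassP/fc_mulA.
Qed.

Fact fpmul1l : left_id (fclass (FLeft 1)) fpmul.
Proof. by elim/fprod_ind=> t; rewrite !fpE; apply/fclassP/fc_mul1l. Qed.

Fact fpmul1r : right_id (fclass (FLeft 1)) fpmul.
Proof. by elim/fprod_ind=> t; rewrite !fpE; apply/fclassP/fc_mul1r. Qed.

Fact fpmulDl : left_distributive fpmul fpadd.
Proof.
by elim/fprod_ind=> t; elim/fprod_ind=> u; elim/fprod_ind=> v;
  rewrite !fpE; apply/fclassP/fc_mulDl.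
Qed.

Fact fpmulDr : right_distributive fpmul fpadd.
Proof.
by elim/fprod_ind=> t; elim/fprod_ind=> u; elim/fprod_ind=> v;
  rewrite !fpE; apply/fclassP/fc_mulDr.
Qed.

HB.instance Definition _ := GRing.Zmodule_isPzRing.Build fprod
  fpmulA fpmul1l fpmul1r fpmulDl fpmulDr.

Fact fpscaleA a b x : fpscale a (fpscale b x) = fpscale (a * b) x.
Proof.
by elim/fprod_ind: x => t; rewrite !fpE; apply/fclassP/fc_scaleA.
Qed.

Fact fpscale1 x : fpscale 1 x = x.
Proof. by elim/fprod_ind: x => t; rewrite !fpE; apply/fclassP/fc_scale1. Qed.

Fact fpscaleDr a x y : fpscale a (x + y) = fpscale a x + fpscale a y.
Proof.
rewrite -[_ + _]/(fpadd _ _) -[RHS]/(fpadd _ _).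
by elim/fprod_ind: x => t; elim/fprod_ind: y => u;
  rewrite !fpE; apply/fclassP/fc_scaleDr.
Qed.

Fact fpscaleDl a b x : fpscale (a + b) x = fpscale a x + fpscale b x.
Proof.
rewrite -[RHS]/(fpadd _ _).
by elim/fprod_ind: x => t; rewrite !fpE; apply/fclassP/fc_scaleDl.
Qed.

Fact fpscaleAl a x y : fpscale a (x * y) = fpscale a x * y.
Proof.
rewrite -[x * y]/(fpmul _ _) -[RHS]/(fpmul _ _).
by elim/fprod_ind: x => t; elim/fprod_ind: y => u;
  rewrite !fpE; apply/fclassP/fc_scaleAl.
Qed.

Fact fpscaleAr a x y : fpscale a (x * y) = x * fpscale a y.
Proof.
rewrite -[x * y]/(fpmul _ _) -[RHS]/(fpmul _ _).
by elim/fprod_ind: x => t; elim/fprod_ind: y => u;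
  rewrite !fpE; apply/fclassP/fc_scaleAr.
Qed.

HB.instance Definition _ := PzRing_isUAlgebra.Build K fprod
  fpscaleA fpscale1 fpscaleDr fpscaleDl fpscaleAl fpscaleAr.

Lemma fclassD t u : fclass (FAdd t u) = fclass t + fclass u.
Proof. by rewrite -fpaddE. Qed.

Lemma fclassM t u : fclass (FMul t u) = fclass t * fclass u.
Proof. by rewrite -fpmulE. Qed.

Lemma fclassZ a t : fclass (FScale a t) = uscale a (fclass t).
Proof. by rewrite -fpscaleE. Qed.

Definition fprodl (x : A) : fprod := fclass (FLeft x).
Definition fprodr (y : B) : fprod := fclass (FRight y).

Fact fprodl_is_nmod : nmod_morphism fprodl.
Proof.
by split=> // x y; rewrite /fprodl -fclassD; apply/fclassP/fc_leftD.
Qed.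

Fact fprodl_is_monoid : monoid_morphism fprodl.
Proof.
by split=> // x y; rewrite /fprodl -fclassM; apply/fclassP/fc_leftM.
Qed.

Fact fprodl_is_scalable (a : K) x : fprodl (uscale a x) = uscale a (fprodl x).
Proof. by rewrite /fprodl -fclassZ; apply/fclassP/fc_leftZ. Qed.

HB.instance Definition _ := GRing.isNmodMorphism.Build A fprod fprodl
  fprodl_is_nmod.
HB.instance Definition _ := GRing.isMonoidMorphism.Build A fprod fprodl
  fprodl_is_monoid.
HB.instance Definition _ := isUScalable.Build K A fprod fprodl
  fprodl_is_scalable.

Fact fprodr_is_scalable (a : K) x : fprodr (uscale a x) = uscale a (fprodr x).
Proof. by rewrite /fprodr -fclassZ; apply/fclassP/fc_rightZ. Qed.

Fact fprodr_is_nmod : nmod_morphism fprodr.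
Proof.
split=> [|x y]; last by rewrite /fprodr -fclassD; apply/fclassP/fc_rightD.
by rewrite -(uscale0r (0 : B)) fprodr_is_scalable uscale0r.
Qed.

Fact fprodr_is_monoid : monoid_morphism fprodr.
Proof.
split=> [|x y]; first by apply/fclassP/fc_right1.
by rewrite /fprodr -fclassM; apply/fclassP/fc_rightM.
Qed.

HB.instance Definition _ := GRing.isNmodMorphism.Build B fprod fprodr
  fprodr_is_nmod.
HB.instance Definition _ := GRing.isMonoidMorphism.Build B fprod fprodr
  fprodr_is_monoid.
HB.instance Definition _ := isUScalable.Build K B fprod fprodr
  fprodr_is_scalable.

Definition freeprod : ualgType K := UAlgebra.clone K fprod _.
Definition freeprod_inl : ualgHom A freeprod := UAlgHom.clone K A fprod fprodl _.
Definition freeprod_inr : ualgHom B freeprod := UAlgHom.clone K B fprod fprodr _.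

Definition freeprod_tens (x : A) (y : B) : freeprod :=
  freeprod_inl x * freeprod_inr y.

Section Copair.
Variables (C : ualgType K) (f : ualgHom A C) (g : ualgHom B C).

Fixpoint feval (t : fterm) : C :=
  match t with
  | FLeft x => f x
  | FRight y => g y
  | FAdd t u => feval t + feval u
  | FMul t u => feval t * feval u
  | FScale a t => uscale a (feval t)
  end.

Lemma feval_cong t u : fcong t u -> feval t = feval u.
Proof.
elim=> {t u} //=; intros.
all: rewrite ?rmorph0 ?rmorph1 ?uscaleN1r.
all: try congruence.
all: rewrite ?(add0r, mul1r, mulr1, rmorphD, rmorphM, uscalable) //.
- exact: addrA.
- exact: addrC.
- exact: addNr.
- exact: mulrA.
- exact: mulrDl.
- exact: mulrDr.
- exact: uscaleA.
- exact: uscale1.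
- exact: uscaleDr.
- exact: uscaleDl.
- exact: uscaleAl.
- exact: uscaleAr.
Qed.

Definition fcopair_fun (x : fprod) : C := feval (frep x).

Lemma fcopair_class t : fcopair_fun (fclass t) = feval t.
Proof. exact/feval_cong/frepP. Qed.

Fact fcopair_is_nmod : nmod_morphism fcopair_fun.
Proof.
split; first by rewrite fcopair_class /= rmorph0.
by elim/fprod_ind=> t; elim/fprod_ind=> u; rewrite -fclassD !fcopair_class.
Qed.

Fact fcopair_is_monoid : monoid_morphism fcopair_fun.
Proof.
split; first by rewrite fcopair_class /= rmorph1.
by elim/fprod_ind=> t; elim/fprod_ind=> u; rewrite -fclassM !fcopair_class.
Qed.

Fact fcopair_is_scalable (a : K) x :
  fcopair_fun (uscale a x) = uscale a (fcopair_fun x).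
Proof. by elim/fprod_ind: x => t; rewrite -fclassZ !fcopair_class. Qed.

HB.instance Definition _ := GRing.isNmodMorphism.Build fprod C fcopair_fun
  fcopair_is_nmod.
HB.instance Definition _ := GRing.isMonoidMorphism.Build fprod C fcopair_fun
  fcopair_is_monoid.
HB.instance Definition _ := isUScalable.Build K fprod C fcopair_fun
  fcopair_is_scalable.

Definition fcopair : ualgHom freeprod C :=
  UAlgHom.clone K fprod C fcopair_fun _.

Lemma freeprod_inlK x : fcopair (freeprod_inl x) = f x.
Proof. exact: fcopair_class. Qed.

Lemma freeprod_inrK y : fcopair (freeprod_inr y) = g y.
Proof. exact: fcopair_class. Qed.

End Copair.

Lemma freeprod_hom_eq (C : ualgType K) (u v : ualgHom freeprod C) :
  (forall x, u (freeprod_inl x) = v (freeprod_inl x)) ->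
  (forall y, u (freeprod_inr y) = v (freeprod_inr y)) -> u = v.
Proof.
move=> uvl uvr; apply: ualgHomP; elim/fprod_ind.
elim=> [x|y|t IHt t' IHt'|t IHt t' IHt'|a t IHt].
- exact: uvl.
- exact: uvr.
- by rewrite fclassD !rmorphD; congr (_ + _).
- by rewrite fclassM !rmorphM; congr (_ * _).
- by rewrite fclassZ !uscalable; congr uscale.
Qed.

End FreeProduct.

Arguments freeprod_inl : simpl never.
Arguments freeprod_inr : simpl never.
Arguments fcopair : simpl never.

Section FreeProductMaps.
Variable K : pzRingType.
Implicit Types A B C D : ualgType K.

Definition freeprod_map A B C D (f : ualgHom A C) (g : ualgHom B D) :
    ualgHom (freeprod A B) (freeprod C D) :=
  fcopair (freeprod_inl C D \oh f) (freeprod_inr C D \oh g).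

Definition freeprod_mul A : ualgHom (freeprod A A) A :=
  fcopair (hom_id A) (hom_id A).

(* The canonical identification of (A * B) * C with A * (B * C). *)
Definition freeprod_assoc A B C :
    ualgHom (freeprod (freeprod A B) C) (freeprod A (freeprod B C)) :=
  fcopair
    (fcopair (freeprod_inl A (freeprod B C))
             (freeprod_inr A (freeprod B C) \oh freeprod_inl B C))
    (freeprod_inr A (freeprod B C) \oh freeprod_inr B C).

Definition freeprod_assoc_inv A B C :
    ualgHom (freeprod A (freeprod B C)) (freeprod (freeprod A B) C) :=
  fcopair
    (freeprod_inl (freeprod A B) C \oh freeprod_inl A B)
    (fcopair (freeprod_inl (freeprod A B) C \oh freeprod_inr A B)
             (freeprod_inr (freeprod A B) C)).

Lemma hom_compE A B C (g : ualgHom B C) (f : ualgHom A B) x :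
  (g \oh f) x = g (f x).
Proof. by []. Qed.

Lemma freeprod_assocK A B C :
  cancel (freeprod_assoc A B C) (freeprod_assoc_inv A B C).
Proof.
move=> x; rewrite -hom_compE.
suff -> : freeprod_assoc_inv A B C \oh freeprod_assoc A B C = hom_id _ by [].
apply: freeprod_hom_eq => [|z]; last first.
  by rewrite hom_compE freeprod_inrK hom_compE !freeprod_inrK.
move=> y; rewrite hom_compE freeprod_inlK -!hom_compE.
congr (UAlgHom.sort _ y); apply: freeprod_hom_eq => z.
  by rewrite !hom_compE !freeprod_inlK.
by rewrite !(hom_compE, freeprod_inrK, freeprod_inlK).
Qed.

Lemma freeprod_assoc_invK A B C :
  cancel (freeprod_assoc_inv A B C) (freeprod_assoc A B C).
Proof.
move=> x; rewrite -hom_compE.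
suff -> : freeprod_assoc A B C \oh freeprod_assoc_inv A B C = hom_id _ by [].
apply: freeprod_hom_eq => [z|].
  by rewrite hom_compE freeprod_inlK hom_compE !freeprod_inlK.
move=> y; rewrite hom_compE freeprod_inrK -!hom_compE.
congr (UAlgHom.sort _ y); apply: freeprod_hom_eq => z.
  by rewrite !(hom_compE, freeprod_inlK, freeprod_inrK).
by rewrite !(hom_compE, freeprod_inrK, freeprod_inlK).
Qed.

End FreeProductMaps.

(* The free algebra K<b_1, b_2, ...>: the monoid algebra of the free monoid on
   nat, the letter n standing for b_(n+1). *)
Section FreeAlgebra.
Variable K : comNzRingType.

Definition hinv_carrier := {malg K[{fmonom nat}]}.

HB.instance Definition _ := GRing.NzRing.on hinv_carrier.

Let hscale (a : K) (x : hinv_carrier) : hinv_carrier :=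
  a *: (x : {malg K[{fmonom nat}]}).

Fact hscaleA a b x : hscale a (hscale b x) = hscale (a * b) x.
Proof. exact: scalerA. Qed.

Fact hscale1 x : hscale 1 x = x.
Proof. exact: scale1r. Qed.

Fact hscaleDr a x y : hscale a (x + y) = hscale a x + hscale a y.
Proof. exact: scalerDr. Qed.

Fact hscaleDl a b x : hscale (a + b) x = hscale a x + hscale b x.
Proof. exact: scalerDl. Qed.

Fact hscaleAl a x y : hscale a (x * y) = hscale a x * y.
Proof. exact: fgscaleAl. Qed.

Lemma malg_commC (a : K) (x : {malg K[{fmonom nat}]}) : a%:MP * x = x * a%:MP.
Proof.
rewrite !malgM_def fgmulUg fgmulgU; apply: eq_bigr => m _.
by rewrite mulrC mul1m mulm1.
Qed.

Fact hscaleAr a x y : hscale a (x * y) = x * hscale a y.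
Proof.
rewrite /hscale -!mul_malgC mulrA.
rewrite -[X in X * y = _]/(a%:MP * (x : {malg K[{fmonom nat}]})) malg_commC.
by rewrite -mulrA.
Qed.

HB.instance Definition _ := PzRing_isUAlgebra.Build K hinv_carrier
  hscaleA hscale1 hscaleDr hscaleDl hscaleAl hscaleAr.

Definition Hinv : ualgType K := UAlgebra.clone K hinv_carrier _.

Definition hgen (n : nat) : Hinv :=
  if n is m.+1 then (<< fmu m >> : {malg K[{fmonom nat}]}) else 1.

(* The algebra homomorphism mapping b_n to x n for all n > 0. *)
Section Lift.
Variables (A : ualgType K) (x : nat -> A).

Definition mlift (m : {fmonom nat}) : A := \prod_(i <- (m : seq nat)) x i.+1.

Definition hlift_fun (g : hinv_carrier) : A :=
  \sum_(m <- msupp (g : {malg K[{fmonom nat}]}))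
     uscale (mcoeff m (g : {malg K[{fmonom nat}]})) (mlift m).

Lemma mlift1 : mlift mone = 1.
Proof. by rewrite /mlift fm1 big_nil. Qed.

Lemma mliftM m1 m2 : mlift (mmul m1 m2) = mlift m1 * mlift m2.
Proof. by rewrite /mlift fmM big_cat. Qed.

Lemma hlift_fun_w (d : {fset {fmonom nat}}) g : (msupp g `<=` d)%fset ->
  hlift_fun g = \sum_(m <- d) uscale (mcoeff m g) (mlift m).
Proof.
move=> le; rewrite [LHS](big_fset_incl _ le) => //= m md /mcoeff_outdom ->.
exact: uscale0r.
Qed.

Lemma hlift_funU a m : hlift_fun << a *g m >> = uscale a (mlift m).
Proof. by rewrite (hlift_fun_w msuppU_le) big_seq_fset1 mcoeffUU. Qed.

Fact hlift_is_nmod : nmod_morphism hlift_fun.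
Proof.
split=> [|g h]; first by rewrite /hlift_fun msupp0 big_seq_fset0.
rewrite (hlift_fun_w (msuppD_le g h)) (hlift_fun_w (fsubsetUl _ (msupp h))).
rewrite (hlift_fun_w (fsubsetUr (msupp g) _)) -big_split /=.
by apply: eq_bigr => m _; rewrite mcoeffD uscaleDl.
Qed.

HB.instance Definition _ := GRing.isNmodMorphism.Build hinv_carrier A hlift_fun
  hlift_is_nmod.

Fact hlift_is_monoid : monoid_morphism hlift_fun.
Proof.
split=> [|g h]; first by rewrite hlift_funU uscale1 mlift1.
rewrite [g * h](malgME g h) raddf_sum mulr_suml; apply: eq_bigr => m _.
rewrite raddf_sum mulr_sumr; apply: eq_bigr => n _.
by rewrite /= hlift_funU mliftM -uscaleAl -uscaleAr uscaleA.
Qed.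

Fact hlift_is_scalable (a : K) g : hlift_fun (uscale a g) = uscale a (hlift_fun g).
Proof.
rewrite (hlift_fun_w (msuppZ_le a g)) uscale_sumr.
by apply: eq_bigr => m _; rewrite uscaleA -mcoeffZ.
Qed.

HB.instance Definition _ := GRing.isMonoidMorphism.Build hinv_carrier A
  hlift_fun hlift_is_monoid.
HB.instance Definition _ := isUScalable.Build K hinv_carrier A hlift_fun
  hlift_is_scalable.

Definition hlift : ualgHom Hinv A := UAlgHom.clone K hinv_carrier A hlift_fun _.

Lemma hlift_gen n : hlift (hgen n.+1) = x n.+1.
Proof.
by rewrite [LHS]hlift_funU uscale1 /mlift fmU big_seq1.
Qed.

End Lift.

Lemma hlift_uniq (A : ualgType K) (f g : ualgHom Hinv A) :
  (forall n, f (hgen n.+1) = g (hgen n.+1)) -> f = g.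
Proof.
move=> fg; apply: ualgHomP => h.
have fgm (s : seq nat) : f (<< FMonom s >> : {malg K[{fmonom nat}]})
    = g (<< FMonom s >> : {malg K[{fmonom nat}]}).
  elim: s => [|n s IHs].
    by rewrite -[FMonom [::]]fmoneE [LHS]rmorph1 [RHS]rmorph1.
  have -> : (<< FMonom (n :: s) >> : {malg K[{fmonom nat}]}) =
      (hgen n.+1 : {malg K[{fmonom nat}]}) * << FMonom s >>.
    rewrite malgM_def fgmulUU mulr1; congr mkmalgU.
    by apply/eqP; rewrite fmP fmM fmU.
  rewrite [LHS]rmorphM [RHS]rmorphM; congr (_ * _) => //; exact: fg.
rewrite [h](monalgE h) [LHS]raddf_sum [RHS]raddf_sum; apply: eq_bigr => m _.
have -> : << h@_m *g m >> = uscale h@_m (<< m >> : Hinv) :> Hinv.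
  by apply/malgP => k; rewrite [RHS]mcoeffZ !mcoeffU mulrnAr mulr1.
rewrite [LHS](uscalable f) [RHS](uscalable g).
by congr uscale; case: m => s; exact: fgm.
Qed.

(* b_n |-> \sum_(k <= n) b_k (x) b_(n-k), with b_0 = 1. *)
Definition Dinv : ualgHom Hinv (freeprod Hinv Hinv) :=
  hlift (fun n => \sum_(k < n.+1) freeprod_tens (hgen k) (hgen (n - k))).

Lemma Dinv_gen n :
  Dinv (hgen n) = \sum_(k < n.+1) freeprod_tens (hgen k) (hgen (n - k)).
Proof.
case: n => [|n]; last exact: hlift_gen.
by rewrite big_ord1 /freeprod_tens !rmorph1 mulr1.
Qed.

Definition conv (A : ualgType K) (f g : ualgHom Hinv A) : ualgHom Hinv A :=
  freeprod_mul A \oh freeprod_map f g \oh Dinv.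

End FreeAlgebra.

Arguments hlift : simpl never.

Definition is_group_law (T : Type) (op : T -> T -> T) : Prop :=
  exists (e : T) (inv : T -> T),
    [/\ associative op, left_id e op, right_id e op,
        left_inverse e inv op & right_inverse e inv op].

(* Formal power series f with f_0 = 1, given by the coefficient sequence f. *)
Section InvertibleSeries.
Variable A : pzRingType.

Record Ginv := MkGinv { gcoef :> nat -> A; gcoef0 : gcoef 0 = 1 }.

Lemma GinvP (f g : Ginv) : f =1 g -> f = g.
Proof.
case: f g => [f f0] [g g0] /= /funext fg; move: g0; rewrite -fg => g0.
by rewrite (Prop_irrelevance g0 f0).
Qed.

HB.instance Definition _ := gen_eqMixin Ginv.
HB.instance Definition _ := gen_choiceMixin Ginv.

Definition gmul_coef (f g : nat -> A) n := \sum_(k < n.+1) f k * g (n - k)%N.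

Fact gmul_coef0 (f g : Ginv) : gmul_coef f g 0 = 1.
Proof. by rewrite /gmul_coef big_ord1 !gcoef0 mulr1. Qed.

Definition gmul (f g : Ginv) := MkGinv (gmul_coef0 f g).
Definition gone := @MkGinv (fun n => (n == 0)%:R) erefl.

Fact gmulA : associative gmul.
Proof.
move=> f g h; apply: GinvP => n /=; rewrite /gmul_coef /=.
under eq_bigr => k _ do rewrite /gmul_coef mulr_sumr.
under [RHS]eq_bigr => k _ do rewrite /gmul_coef mulr_suml.
rewrite [LHS](eq_bigr (fun k : 'I_n.+1 => \sum_(j < n.+1 | (k <= j)%N)
   f k * g (j - k)%N * h (n - j)%N)); last first.
  move=> k _; rewrite -(big_mkord (fun j => (k <= j)%N)
    (fun j => f k * g (j - k)%N * h (n - j)%N)).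
  rewrite (big_cat_nat _ (n := k)) //=; last exact: ltnW (ltn_ord k).
  rewrite [X in _ = X + _]big_nat_cond [X in _ = X + _]big_pred0; last first.
    by move=> j; case: (ltnP j k) => //= jk; rewrite andbF.
  rewrite add0r [RHS]big_nat_cond [RHS](eq_bigl (fun j => (k <= j < n.+1)%N));
    last by move=> j; case: (k <= j)%N; rewrite ?andbT ?andbF.
  rewrite -[RHS]big_nat -[X in _ = \sum_(X <= _ < _) _]add0n big_addn.
  rewrite big_mkord subSn; last by rewrite -ltnS.
  by apply: eq_bigr => j _; rewrite addnK mulrA addnC subnDA.
rewrite [RHS](eq_bigr (fun j : 'I_n.+1 => \sum_(k < n.+1 | (k <= j)%N)
   f k * g (j - k)%N * h (n - j)%N)); last first.
  move=> j _; rewrite (big_ord_widen_cond n.+1 xpredT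
    (fun k => f k * g (j - k)%N * h (n - j)%N)) //.
rewrite (exchange_big_dep xpredT) //=.
Qed.

Fact gmul1g : left_id gone gmul.
Proof.
move=> f; apply: GinvP => n; rewrite /= /gmul_coef big_ord_recl subn0 mul1r.
by rewrite big1 ?addr0 // => k _; rewrite mul0r.
Qed.

Fact gmulg1 : right_id gone gmul.
Proof.
move=> f; apply: GinvP => n; rewrite /= /gmul_coef big_ord_recr subnn mulr1 /=.
rewrite big1 ?add0r // => k _.
by rewrite subn_eq0 leqNgt ltn_ord mulr0.
Qed.

(* The inverse of f, with coefficients g_n = - \sum_(k < n) g_k f_(n-k). *)
Fixpoint ginv_seq (f : nat -> A) n : seq A :=
  if n is m.+1 then
    let s := ginv_seq f m in
    rcons s (- \sum_(k < m.+1) nth 0 s k * f (m.+1 - k)%N)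
  else [:: 1].

Definition ginv_coef f n := nth 0 (ginv_seq f n) n.

Lemma size_ginv_seq f n : size (ginv_seq f n) = n.+1.
Proof. by elim: n => //= n IHn; rewrite size_rcons IHn. Qed.

Lemma nth_ginv_seq f n k :
  (k <= n)%N -> nth 0 (ginv_seq f n) k = ginv_coef f k.
Proof.
elim: n => [|n IHn]; first by rewrite leqn0 => /eqP->.
rewrite leq_eqVlt => /predU1P[-> //|]; rewrite ltnS => kn.
by rewrite /= nth_rcons size_ginv_seq ltnS kn IHn.
Qed.

Lemma ginv_coefS f n :
  ginv_coef f n.+1 = - \sum_(k < n.+1) ginv_coef f k * f (n.+1 - k)%N.
Proof.
rewrite {1}/ginv_coef /= nth_rcons size_ginv_seq ltnn eqxx; congr (- _).
by apply: eq_bigr => k _; rewrite nth_ginv_seq // -ltnS.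
Qed.

Definition ginv (f : Ginv) := @MkGinv (ginv_coef f) erefl.

Fact gmulVg : left_inverse gone ginv gmul.
Proof.
move=> f; apply: GinvP => -[|n]; first by rewrite gcoef0.
rewrite /= /gmul_coef big_ord_recr /= subnn gcoef0 mulr1 ginv_coefS.
exact: subrr.
Qed.

Fact gmulgV : right_inverse gone ginv gmul.
Proof.
move=> f; rewrite -[LHS]gmul1g -{1}(gmulVg (ginv f)) -gmulA.
by rewrite [gmul _ (gmul f _)]gmulA gmulVg gmul1g gmulVg.
Qed.

HB.instance Definition _ := isGroup.Build Ginv
  gmulA gmul1g gmulg1 gmulVg gmulgV.

End InvertibleSeries.

(* Main.v *)
Require Import Defs.
From mathcomp Require Import all_boot all_algebra.
From mathcomp Require Import reals.
From mathcomp Require Import complex.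

(** Since the b_n generate the free algebra H freely, a homomorphism H -> A is
    an arbitrary sequence of values f_n in A at the b_n, that is, a power series
    with constant term 1 ([series_hom] and [hom_series]).  By the formula for
    Delta b_n, the convolution of two homomorphisms has at b_n the value
    sum_k f_k g_(n-k) ([conv_gen]), the coefficient of the product of the two
    series.  So series and homomorphisms carry the same product, and the group
    laws of convolution are those of invertible series ([is_group_law_conv]).

    Co-associativity is a consequence of these group laws, by a Yoneda argument
    rather than a computation with double sums.  If [f, g] denotes the
    homomorphism induced on the free product H * H by f, g : H -> A, then
    [f, g] o Delta is the convolution f g ([fcopair_Dinv]); consequently
    u o (f g) = (u o f) (u o g) for every u : A -> B ([hom_comp_conv]).  Let
    i_1, i_2, i_3 be the three embeddings of H into H * (H * H).  Then the two
    sides of the co-associativity identity are (i_1 i_2) i_3 and i_1 (i_2 i_3),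
    which agree because convolution on Hom(H, H * (H * H)) is associative
    ([Dinv_coassoc]). *)

Import GRing.Theory.
Local Open Scope ring_scope.

Lemma is_group_law_transport {T U : Type} {opT : T -> T -> T}
    {opU : U -> U -> U} {phi : T -> U} :
  bijective phi -> {morph phi : x y / opT x y >-> opU x y} ->
  is_group_law opT -> is_group_law opU.
Proof.
move=> [psi phiK psiK] phiM [e [inv [opA op1x opx1 opVx opxV]]].
have opUE x y : opU x y = phi (opT (psi x) (psi y)) by rewrite phiM !psiK.
exists (phi e), (fun x => phi (inv (psi x))).
split=> [x y z|x|x|x|x]; rewrite !opUE !phiK.
- by rewrite opA.
- by rewrite op1x psiK.
- by rewrite opx1 psiK.
- by rewrite opVx.
- by rewrite opxV.
Qed.

Lemma hom_compA (K : pzRingType) (A B C D : ualgType K) (h : ualgHom C D)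
    (g : ualgHom B C) (f : ualgHom A B) :
  h \oh (g \oh f) = h \oh g \oh f.
Proof. exact: ualgHomP. Qed.

Lemma hom_comp_id (K : pzRingType) (A B : ualgType K) (f : ualgHom A B) :
  f \oh hom_id A = f.
Proof. exact: ualgHomP. Qed.

Section Copairing.
Context {K : pzRingType} {A B C : ualgType K}.

Lemma fcopair_inl (f : ualgHom A C) (g : ualgHom B C) :
  fcopair f g \oh freeprod_inl A B = f.
Proof. by apply: ualgHomP => x; apply: freeprod_inlK. Qed.

Lemma fcopair_inr (f : ualgHom A C) (g : ualgHom B C) :
  fcopair f g \oh freeprod_inr A B = g.
Proof. by apply: ualgHomP => y; apply: freeprod_inrK. Qed.

Lemma hom_comp_fcopair {D : ualgType K} (u : ualgHom C D)
    (f : ualgHom A C) (g : ualgHom B C) :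
  u \oh fcopair f g = fcopair (u \oh f) (u \oh g).
Proof.
by apply: freeprod_hom_eq => x;
  rewrite hom_compE ?freeprod_inlK ?freeprod_inrK.
Qed.

End Copairing.

Lemma freeprod_mul_map (K : pzRingType) (A B C : ualgType K)
    (f : ualgHom A C) (g : ualgHom B C) :
  freeprod_mul C \oh freeprod_map f g = fcopair f g.
Proof.
rewrite /freeprod_map hom_comp_fcopair !hom_compA fcopair_inl fcopair_inr.
by congr fcopair; apply: ualgHomP.
Qed.

Section Convolution.
Context {K : comNzRingType}.
Local Notation H := (Hinv K).
Local Notation Delta := (Dinv K).

(** The co-product represents convolution: with [A := freeprod H H] and the two
    embeddings for [f] and [g], [Delta] itself becomes a convolution, and
    composites built from [Delta] become products of embeddings. *)
Lemma fcopair_Dinv {A : ualgType K} (f g : ualgHom H A) :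
  fcopair f g \oh Delta = conv f g.
Proof. by rewrite /conv freeprod_mul_map. Qed.

Lemma conv_gen {A : ualgType K} (f g : ualgHom H A) n :
  conv f g (hgen K n) = \sum_(k < n.+1) f (hgen K k) * g (hgen K (n - k)).
Proof.
rewrite -fcopair_Dinv hom_compE Dinv_gen rmorph_sum.
apply: eq_bigr => k _; rewrite [LHS]rmorphM.
by congr (_ * _); [apply: freeprod_inlK | apply: freeprod_inrK].
Qed.

Lemma hom_comp_conv {A B : ualgType K} (u : ualgHom A B) (f g : ualgHom H A) :
  u \oh conv f g = conv (u \oh f) (u \oh g).
Proof. by rewrite -!fcopair_Dinv hom_compA hom_comp_fcopair. Qed.

Section Series.
Context {A : ualgType K}.

Definition series_hom (f : Ginv A) : ualgHom H A := hlift f.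

Fact hom_series_subproof (f : ualgHom H A) : f (hgen K 0) = 1.
Proof. exact: rmorph1. Qed.

Definition hom_series (f : ualgHom H A) : Ginv A :=
  @MkGinv A (fun n => f (hgen K n)) (hom_series_subproof f).

Lemma series_hom_gen (f : Ginv A) n : series_hom f (hgen K n) = f n.
Proof. by case: n => [|n]; [rewrite rmorph1 gcoef0 | apply: hlift_gen]. Qed.

Lemma series_hom_bij : bijective series_hom.
Proof.
exists hom_series => f; first by apply: GinvP => n; apply: series_hom_gen.
by apply: hlift_uniq => n; apply: series_hom_gen.
Qed.

Lemma series_homM : {morph series_hom : f g / (f * g)%g >-> conv f g}.
Proof.
move=> f g; apply: hlift_uniq => n; rewrite series_hom_gen conv_gen.
by apply: eq_bigr => k _; rewrite !series_hom_gen.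
Qed.

Lemma is_group_law_conv : is_group_law (fun f g : ualgHom H A => conv f g).
Proof.
apply: (is_group_law_transport series_hom_bij series_homM).
exists (gone A), (@ginv A); split.
- exact: gmulA.
- exact: gmul1g.
- exact: gmulg1.
- exact: gmulVg.
- exact: gmulgV.
Qed.

Lemma convA (f g h : ualgHom H A) : conv f (conv g h) = conv (conv f g) h.
Proof. by have [e [inv [cA _ _ _ _]]] := is_group_law_conv; apply: cA. Qed.

End Series.

Lemma Dinv_coassoc :
  freeprod_assoc H H H \oh (freeprod_map Delta (hom_id H) \oh Delta)
    = freeprod_map (hom_id H) Delta \oh Delta.
Proof.
have DeltaE : Delta = conv (freeprod_inl H H) (freeprod_inr H H).
  rewrite -fcopair_Dinv; apply: ualgHomP => x; rewrite hom_compE.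
  suff -> : fcopair (freeprod_inl H H) (freeprod_inr H H) = hom_id _ by [].
  by apply: freeprod_hom_eq => y; rewrite ?freeprod_inlK ?freeprod_inrK.
rewrite /freeprod_map !fcopair_Dinv !hom_comp_id hom_comp_conv hom_compA.
rewrite /freeprod_assoc fcopair_inl fcopair_inr DeltaE !hom_comp_conv.
by rewrite fcopair_inl fcopair_inr convA.
Qed.

End Convolution.

Theorem proposition1p1 (R : realType) :
  let H : ualgType R[i] := Hinv R[i] in
  let Delta : ualgHom H (freeprod H H) := Dinv R[i] in
  freeprod_assoc H H H \oh (freeprod_map Delta (hom_id H) \oh Delta)
    = freeprod_map (hom_id H) Delta \oh Delta
  /\ forall A : ualgType R[i],
       is_group_law (fun f g : ualgHom H A => conv f g)
       /\ exists phi : Ginv A -> ualgHom H A,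
            bijective phi /\ {morph phi : f g / (f * g)%g >-> conv f g}.
Proof.
move=> H Delta; split=> [|A]; first exact: Dinv_coassoc.
split; first exact: is_group_law_conv.
by exists series_hom; split; [apply: series_hom_bij | apply: series_homM].
Qed.
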